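(* Let $K=\mathbb{F}_q$ be a finite field with $q\neq 2$, and let $G$ be a graph with $s$ edges. Let $X$, $Y$, $I(X)\subset S=K[t_1,\ldots,t_s]$ and $I(Y)\subset S[u]=K[t_1,\ldots,t_s,t_{s+1}]$ be as defined in the context. If $G$ is bipartite or if $\gcd(q-1,2)=1$, then $$I(Y)=I(X)+(t_1^{q-1}-t_{s+1}^{q-1}),$$ where $I(X)$ on the right-hand side denotes its extension $I(X)S[u]$.
   Context: Graphs are finite and simple. Let $G$ have vertex set $\{y_1,\ldots,y_n\}$ and edges $f_1,\ldots,f_s$ ($s\geq 1$), and let $v_i=e_j+e_k\in\{0,1\}^n$ be the characteristic vector of $f_i=\{y_j,y_k\}$. Put $K^*=K\setminus\{0\}$ and, for $x\in (K^* )^n$, $x^{v_i}=x_1^{v_{i1}}\cdots x_n^{v_{in}}$. Define $X=\{[(x^{v_1},\ldots,x^{v_s})] : x\in (K^* )^n\}\subset\mathbb{P}^{s-1}$ and $Y=\{[(x^{v_1},\ldots,x^{v_s},1)] : x\in (K^* )^n\}\subset\mathbb{P}^{s}$, projective spaces over $K$. The rings $S=K[t_1,\ldots,t_s]$ and $S[u]$, $u=t_{s+1}$, are polynomial rings with the standard grading. $I(X)$ (resp. $I(Y)$) is the ideal of $S$ (resp. $S[u]$) generated by the homogeneous polynomials that vanish on $X$ (resp. $Y$). *)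

(* Defs.v *)
From HB Require Import structures.
From mathcomp Require Export all_boot all_order all_algebra.
From mathcomp Require Export mpoly.

Set Implicit Arguments.
Unset Strict Implicit.
Unset Printing Implicit Defensive.

Import GRing.Theory.
Local Open Scope ring_scope.

Definition simple_graph (n : nat) (e : rel 'I_n) : Prop :=
  ssrbool.symmetric e /\ irreflexive e.

Definition edges (n : nat) (e : rel 'I_n) : {set {set 'I_n}} :=
  [set F : {set 'I_n} | [exists j, exists k, e j k && (F == [set j; k])]].

Definition edge_listing (n s : nat) (e : rel 'I_n) (f : 'I_s -> {set 'I_n}) :
    Prop :=
  injective f /\ f @: [set: 'I_s] = edges e.

Definition bipartite (n : nat) (e : rel 'I_n) : Prop :=
  exists A : {set 'I_n}, forall j k, e j k -> (j \in A) != (k \in A).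

Definition charvec (n : nat) (F : {set 'I_n}) (j : 'I_n) : nat := j \in F.

Definition monval (K : fieldType) (n : nat) (x : 'rV[K]_n) (v : 'I_n -> nat) :
    K :=
  \prod_(j < n) x 0 j ^+ v j.

(* The projective space of dimension m - 1 over K: the lines through the
   origin in K^m, so that the point [w] is the span <[w]> of w != 0. *)
Definition pspace (K : fieldType) (m : nat) : Type :=
  {P : {vspace 'rV[K]_m} | \dim P == 1%N}.

Definition projX (K : fieldType) (n s : nat) (f : 'I_s -> {set 'I_n})
    (P : pspace K s) : Prop :=
  exists x : 'rV[K]_n, (forall j, x 0 j != 0) /\
    val P = <[ \row_(i < s) monval x (charvec (f i)) ]>%VS.

(* unlift ord_max i is None exactly for the last of the s + 1 coordinates. *)
Definition projY (K : fieldType) (n s : nat) (f : 'I_s -> {set 'I_n})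
    (P : pspace K s.+1) : Prop :=
  exists x : 'rV[K]_n, (forall j, x 0 j != 0) /\
    val P = <[ \row_(i < s.+1)
                 if unlift ord_max i is Some i' then monval x (charvec (f i'))
                 else 1 ]>%VS.

(* For homogeneous g, vanishing does not depend on the representative w. *)
Definition vanishes_at (K : fieldType) (m : nat) (g : {mpoly K[m]})
    (P : pspace K m) : Prop :=
  forall w : 'rV[K]_m, w != 0 -> w \in val P -> g.@[fun i => w 0 i] = 0.

Definition ideal_gen (R : comNzRingType) (G : R -> Prop) (h : R) : Prop :=
  exists (r : nat) (a g : 'I_r -> R),
    (forall i, G (g i)) /\ h = \sum_(i < r) a i * g i.

Definition ideal_add (R : comNzRingType) (I J : R -> Prop) (h : R) : Prop :=
  exists a b : R, I a /\ J b /\ h = a + b.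

Definition vanishing_ideal (K : fieldType) (m : nat) (Z : pspace K m -> Prop) :
    {mpoly K[m]} -> Prop :=
  ideal_gen (fun g : {mpoly K[m]} =>
    (exists d : nat, g \is d.-homog) /\ (forall P, Z P -> vanishes_at g P)).

(* The extension I S[u] of an ideal I of S = K[t_1, ..., t_m]; mwiden is the
   inclusion of S in S[u], where u = 'X_ord_max. *)
Definition extension (K : fieldType) (m : nat) (I : {mpoly K[m]} -> Prop) :
    {mpoly K[m.+1]} -> Prop :=
  ideal_gen (fun g : {mpoly K[m.+1]} => exists2 h, I h & g = mwiden h).

(* Main.v *)
(* Write N = q - 1.  Modulo t_1^N - u^N, every h in I(Y) of degree d reduces to
   \sum_(k < N) c_k u^k with c_k in S homogeneous of degree d - k.  Under either
   hypothesis on G, each l in K^* is the common value x^(v_1) = .. = x^(v_s) for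
   some x in (K^* )^n, so the set of vectors (x^(v_1), .., x^(v_s)) is stable
   under scaling.  Hence the reduction of h vanishes at (w, m) for every
   representative w of a point of X and every m in K^*, that is,
   \sum_k c_k(w) T^k has the N elements of K^* as roots; so c_k(w) = 0. *)
Require Import Defs.
From mathcomp Require Import finfield.
Import GRing.Theory.
Local Open Scope ring_scope.

(** * Ideals as predicates and their generators *)

Definition is_ideal (R : comNzRingType) (I : R -> Prop) : Prop :=
  [/\ I 0, forall a b, I a -> I b -> I (a + b) & forall a b, I b -> I (a * b)].

Section Ideals.
Variable R : comNzRingType.
Implicit Types (I J G : R -> Prop).

Lemma is_ideal_sum I (A : Type) (r : seq A) (P : pred A) (F : A -> R) :
  is_ideal R I -> (forall i, P i -> I (F i)) -> I (\sum_(i <- r | P i) F i).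
Proof. by move=> [I0 ID _] IF; apply: (big_ind I). Qed.

Lemma ideal_gen_is_ideal G : is_ideal R (ideal_gen G).
Proof.
split.
- by exists 0%N, (fun=> 0), (fun=> 0); split=> [[]//|]; rewrite big_ord0.
- move=> a b [r1 [a1 [g1 [G1 ->]]]] [r2 [a2 [g2 [G2 ->]]]].
  exists (r1 + r2)%N.
  exists (fun i => match split i with inl j => a1 j | inr j => a2 j end).
  exists (fun i => match split i with inl j => g1 j | inr j => g2 j end).
  split=> [i|]; first by case: (split i).
  rewrite big_split_ord /=; congr (_ + _); apply: eq_bigr => i _.
    by rewrite (unsplitK (inl i)).
  by rewrite (unsplitK (inr i)).
- move=> a b [r [c [g [Gg ->]]]]; exists r, (fun i => a * c i), g; split=> //.
  by rewrite big_distrr; apply: eq_bigr => i _; rewrite /= mulrA.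
Qed.

Lemma mem_ideal_gen G g : G g -> ideal_gen G g.
Proof.
by move=> Gg; exists 1%N, (fun=> 1), (fun=> g); rewrite big_ord1 mul1r.
Qed.

(** Reduces containments to a check on generators; later [I] is also the kernel of an evaluation or
    a preimage under [mwiden]. *)
Lemma ideal_gen_min G I h :
  is_ideal R I -> (forall g, G g -> I g) -> ideal_gen G h -> I h.
Proof.
move=> idI GI [r [a [g [Gg ->]]]]; apply: is_ideal_sum => // i _.
by case: idI => _ _ IM; apply/IM/GI.
Qed.

Lemma ideal_add_is_ideal I J :
  is_ideal R I -> is_ideal R J -> is_ideal R (ideal_add I J).
Proof.
move=> [I0 ID IM] [J0 JD JM]; split.
- by exists 0, 0; rewrite addr0.
- move=> _ _ [a1 [b1 [Ia1 [Jb1 ->]]]] [a2 [b2 [Ia2 [Jb2 ->]]]].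
  by exists (a1 + a2), (b1 + b2); rewrite addrACA; do !split; auto.
- move=> c _ [a [b [Ia [Jb ->]]]].
  by exists (c * a), (c * b); rewrite mulrDr; do !split; auto.
Qed.

End Ideals.

(** * The inclusion of S in S[u] *)

Lemma meval_mwiden (R : comNzRingType) (n : nat) (p : {mpoly R[n]})
    (w : 'I_n.+1 -> R) :
  (mwiden p).@[w] = p.@[fun i => w (widen_ord (leqnSn n) i)].
Proof.
rewrite {1}[p]mpolyE (big_morph _ (@mwidenD _ _) (mwiden0 _ _)).
rewrite (big_morph _ (mevalD _) (meval0 _)) [RHS]mevalE; apply: eq_bigr => m _.
rewrite mwidenZ mevalZ mwidenX mevalX big_ord_recr /= mnmwiden_ordmax mulr1.
by congr (_ * _); apply: eq_bigr => i _; rewrite mnmwiden_widen.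
Qed.

Lemma dhomog_mwiden (R : comNzRingType) (n d : nat) (p : {mpoly R[n]}) :
  p \is d.-homog -> mwiden p \is d.-homog.
Proof.
move=> hp; rewrite [p]mpolyE (big_morph _ (@mwidenD _ _) (mwiden0 _ _)) big_seq.
apply: rpred_sum => m mp.
rewrite mwidenZ mwidenX dhomogZ // dhomogX /=.
rewrite -(dhomog_mf hp mp) !mdegE big_ord_recr /= mnmwiden_ordmax addn0.
by rewrite mdegE; apply/eqP/eq_bigr => i _; rewrite mnmwiden_widen.
Qed.

(** * Division by t_1^N - u^N *)

Section LastVariable.
Variables (R : comNzRingType) (s N : nat).

Let D : {mpoly R[s.+2]} := 'X_ord0 ^+ N - 'X_ord_max ^+ N.

(* Up to multiples of D, the monomial m equals u ^ (m ord_max %% N) times the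
   monomial [fold_last m] of the first s + 1 variables. *)
Let fold_last (m : 'X_{1..s.+2}) : 'X_{1..s.+1} :=
  ([multinom m (widen_ord (leqnSn s.+1) i) | i < s.+1]
     + U_(ord0) *+ (N * (m ord_max %/ N)))%MM.

(** Folding trades each factor u^N for t_1^N, so the total degree is kept; this makes the reduction
    respect homogeneity. *)
Lemma mdeg_fold_last m :
  (mdeg (fold_last m) + m ord_max %% N)%N = mdeg m.
Proof.
rewrite mdegD mdegMn mdeg1 mul1n mulnC -addnA -divn_eq !mdegE.
rewrite [RHS]big_ord_recr; congr (_ + _)%N.
by apply: eq_bigr => i _; rewrite mnmE.
Qed.

Lemma mpolyX_fold_last m :
  ideal_gen (fun g => g = D)
    ('X_[m] - mwiden 'X_[fold_last m] * 'X_ord_max ^+ (m ord_max %% N)).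
Proof.
set m' := [multinom m (widen_ord (leqnSn s.+1) i) | i < s.+1].
set a := (m ord_max %/ N)%N; set r := (m ord_max %% N)%N.
have -> : 'X_[R, m] = mwiden 'X_[m'] * 'X_ord_max ^+ m ord_max.
  rewrite mwidenX [LHS]mpolyXE_id (mpolyXE_id _ (mnmwiden m')).
  rewrite [LHS]big_ord_recr [in RHS]big_ord_recr /=.
  rewrite mnmwiden_ordmax expr0 mulr1; congr (_ * _).
  by apply: eq_bigr => i _; rewrite mnmwiden_widen mnmE.
rewrite /fold_last mpolyXD -mpolyXn rmorphM rmorphXn /= mwidenX -/m' -/a.
rewrite mwidenX mnmwiden1.
have -> : widen_ord (leqnSn s.+1) ord0 = ord0 by apply/val_inj.
(* With the common factors pulled out, what remains is (u^N)^a - (t_1^N)^a, a multiple of u^N -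
   t_1^N. *)
rewrite {1}(divn_eq (m ord_max) N) -/a -/r mulnC exprD -!mulrA -mulrBr -mulrBl.
rewrite !exprM.
have [_ _ DM] := ideal_gen_is_ideal _ (fun g => g = D).
apply: (DM); rewrite mulrC; apply: (DM).
by rewrite -opprB subrXX -mulrN mulrC; apply/DM/mem_ideal_gen.
Qed.

(** The monomials of [p] are grouped by their u-exponent modulo N. The truncation in [d - k] is
    harmless: for k > d the group is empty and [c k] is 0. *)
Lemma reduce_last (p : {mpoly R[s.+2]}) : (0 < N)%N ->
  exists c : 'I_N -> {mpoly R[s.+1]},
    (forall d, p \is d.-homog -> forall k : 'I_N, c k \is (d - k).-homog) /\
    ideal_gen (fun g => g = D)
      (p - \sum_(k < N) mwiden (c k) * 'X_ord_max ^+ k).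
Proof.
move=> N0; pose r (m : 'X_{1..s.+2}) := Ordinal (ltn_pmod (m ord_max) N0).
exists (fun k => \sum_(m <- msupp p | r m == k) p@_m *: 'X_[fold_last m]).
split=> [d hp k|].
  rewrite big_seq_cond; apply: rpred_sum => m /andP[mp /eqP rk].
  rewrite dhomogZ // dhomogX /= -(dhomog_mf hp mp) /= -mdeg_fold_last -rk.
  by rewrite addnK.
have -> : \sum_(k < N) mwiden (\sum_(m <- msupp p | r m == k)
               p@_m *: 'X_[fold_last m]) * 'X_ord_max ^+ k =
    \sum_(m <- msupp p)
       p@_m *: (mwiden 'X_[fold_last m] * 'X_ord_max ^+ (m ord_max %% N)).
  rewrite [RHS](partition_big r predT) //; apply: eq_bigr => k _.
  rewrite (big_morph _ (@mwidenD _ _) (mwiden0 _ _)) mulr_suml.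
  by apply: eq_bigr => m /eqP <-; rewrite mwidenZ -scalerAl.
rewrite {1}[p]mpolyE -sumrB; apply: is_ideal_sum => [|m _].
  exact: ideal_gen_is_ideal.
rewrite -scalerBr -mul_mpolyC.
have [_ _] := ideal_gen_is_ideal _ (fun g => g = D); apply.
exact: mpolyX_fold_last.
Qed.

End LastVariable.

(** * Projective points, monomial values and finite-field facts *)

Lemma vanishes_at_line (K : fieldType) (m : nat) (r : 'rV[K]_m)
    (g : {mpoly K[m]}) : r != 0 ->
  (forall P : pspace K m, val P = <[r]>%VS -> vanishes_at g P) <->
  (forall c, c != 0 -> g.@[fun i => c * r 0 i] = 0).
Proof.
move=> r0; split=> [gP c c0|gc P Pr w w0].
  have dr : \dim <[r]>%VS == 1%N by rewrite dim_vline r0.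
  have := gP (exist _ <[r]>%VS dr) erefl (c *: r).
  rewrite scaler_eq0 negb_or c0 r0 /= memvZ ?memv_line // => /(_ isT isT) <-.
  by apply: meval_eq => i; rewrite mxE.
rewrite Pr => /vlineP[c wE]; have c0 : c != 0.
  by apply: contraNneq w0 => c0; rewrite wE c0 scale0r.
by rewrite -[RHS](gc c c0); apply: meval_eq => i; rewrite wE mxE.
Qed.

Section Monomials.
Variables (K : fieldType) (n : nat).
Implicit Types (x z : 'rV[K]_n) (v : 'I_n -> nat).

Lemma monval_neq0 x v : (forall j, x 0 j != 0) -> monval x v != 0.
Proof. by move=> x0; apply/prodf_neq0 => j _; rewrite expf_neq0. Qed.

Lemma monvalM x z v :
  monval (\row_j (x 0 j * z 0 j)) v = monval x v * monval z v.
Proof.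
by rewrite -big_split; apply: eq_bigr => j _; rewrite mxE exprMn.
Qed.

Lemma monval_edge z (j k : 'I_n) :
  j != k -> monval z (charvec [set j; k]) = z 0 j * z 0 k.
Proof.
move=> jk; rewrite /monval (bigD1 j) //= (bigD1 k) 1?eq_sym //= big1 ?mulr1.
  by rewrite /charvec !inE !eqxx orbT.
by move=> i /andP[ij ik]; rewrite /charvec !inE (negPf ij) (negPf ik).
Qed.

End Monomials.

(* In the bipartite case one side of the bipartition is scaled by l; otherwise
   #|K| is even, so that l has the square root l ^ (#|K| / 2). *)
Lemma exists_uniform_scaling (K : finFieldType) (n s : nat) (e : rel 'I_n)
    (f : 'I_s -> {set 'I_n}) (l : K) :
  simple_graph e -> edge_listing e f ->
  bipartite e \/ gcdn (#|K| - 1) 2 = 1%N -> l != 0 ->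
  exists2 z : 'rV[K]_n, forall j, z 0 j != 0 &
    forall i, monval z (charvec (f i)) = l.
Proof.
move=> [_ eI] [_ fE] hG l0.
suff [z z0 zE] : exists2 z : 'rV[K]_n, forall j, z 0 j != 0 &
    forall j k, e j k -> z 0 j * z 0 k = l.
  exists z => // i; have : f i \in edges e by rewrite -fE imset_f.
  rewrite inE => /existsP[j /existsP[k /andP[ejk /eqP ->]]].
  rewrite monval_edge ?zE //.
  by apply: contraTneq ejk => ->; rewrite eI.
case: hG => [[A hA]|oddq].
  exists (\row_j if j \in A then l else 1) => [j|j k /hA].
    by rewrite mxE; case: ifP => _ //; apply: oner_neq0.
  by rewrite !mxE; case: (j \in A); case: (k \in A) => //= _;
    rewrite ?mul1r ?mulr1.
exists (\row__ l ^+ #|K|./2) => [j|j k _]; first by rewrite mxE expf_neq0.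
rewrite !mxE -exprD addnn -[RHS]expf_card; congr (_ ^+ _).
have : odd (#|K| - 1).
  by rewrite -[odd _]negbK -dvdn2; apply/negP => /gcdn_idPr; rewrite oddq.
rewrite oddB; last by apply/card_gt0P; exists 0.
by rewrite addbT => /negPf oK; rewrite -[RHS]odd_double_half oK.
Qed.

Lemma expf_card_pred (K : finFieldType) (c : K) :
  c != 0 -> c ^+ (#|K| - 1) = 1.
Proof.
move=> c0; apply: (mulfI c0); rewrite -exprS subn1 mulr1 prednK ?expf_card //.
by apply/card_gt0P; exists 0.
Qed.

(* The polynomial \sum_k a_k T^k has degree below the number of its roots. *)
Lemma coef_eq0_of_vanishes_on_units (K : finFieldType)
    (a : 'I_(#|K| - 1) -> K) :
  (forall c, c != 0 -> \sum_k a k * c ^+ k = 0) -> forall k, a k = 0.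
Proof.
(* The default 0 is never reached, since [\poly_] stops at the same bound. *)
move=> ha k; pose p := \poly_(i < #|K| - 1) oapp a 0 (insub i).
have pE i : p`_(i : 'I_(#|K| - 1)) = a i.
  rewrite coef_poly ltn_ord insubT ?ltn_ord //= => lt.
  by congr a; apply/val_inj.
suff p0 : p = 0 by rewrite -pE p0 coef0.
apply: (@roots_geq_poly_eq0 _ _ (enum [set~ (0 : K)])).
- apply/allP => c; rewrite mem_enum !inE => c0; apply/rootP.
  rewrite (horner_coef_wide _ (size_poly _ _)) -[RHS](ha c c0).
  by apply: eq_bigr => i _; rewrite pE.
- exact: enum_uniq.
- by rewrite -cardE cardsC1 -subn1 size_poly.
Qed.

(** * Vanishing on X and Y in coordinates *)

Section Graph.
Variables (K : finFieldType) (n s : nat) (f : 'I_s.+1 -> {set 'I_n}).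

Lemma vanishes_projX (g : {mpoly K[s.+1]}) :
  (forall P, projX f P -> vanishes_at g P) <->
  (forall x : 'rV[K]_n, (forall j, x 0 j != 0) -> forall c, c != 0 ->
     g.@[fun i => c * monval x (charvec (f i))] = 0).
Proof.
(* A row spans a projective point only if it is nonzero; here the coordinate of the first edge is a
   product of units. *)
have row0 (x : 'rV[K]_n) : (forall j, x 0 j != 0) ->
    \row_i monval x (charvec (f i)) != 0.
  move=> x0; apply: contraNneq (monval_neq0 _ _ x (charvec (f ord0)) x0).
  by move/rowP/(_ ord0); rewrite !mxE => ->.
split=> [gX x x0 c c0|gx P [x [x0 Px]]].
  rewrite -[RHS](proj1 (vanishes_at_line _ _ _ g (row0 x x0)) _ c c0).
    by apply: meval_eq => i; rewrite mxE.
  by move=> P Px; apply: gX; exists x.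
apply: (proj2 (vanishes_at_line _ _ _ g (row0 x x0))) Px => c c0.
by rewrite -[RHS](gx x x0 c c0); apply: meval_eq => i; rewrite mxE.
Qed.

Lemma vanishes_projY (h : {mpoly K[s.+2]}) :
  (forall P, projY f P -> vanishes_at h P) <->
  (forall x : 'rV[K]_n, (forall j, x 0 j != 0) -> forall c, c != 0 ->
     h.@[fun i => c * oapp (fun i' => monval x (charvec (f i'))) 1
                        (unlift ord_max i)] = 0).
Proof.
pose r (x : 'rV[K]_n) := \row_(i < s.+2)
  if unlift ord_max i is Some i' then monval x (charvec (f i')) else 1.
have rE x i : r x 0 i = oapp (fun i' => monval x (charvec (f i'))) 1
                             (unlift ord_max i).
  by rewrite mxE; case: unlift.
have r0 x : r x != 0.
  apply/eqP => /rowP/(_ ord_max)/eqP.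
  by rewrite rE mxE unlift_none oner_eq0.
split=> [hY x x0 c c0|hx P [x [x0 Px]]].
  rewrite -[RHS](proj1 (vanishes_at_line _ _ _ h (r0 x)) _ c c0).
    by apply: meval_eq => i; rewrite rE.
  by move=> P Px; apply: hY; exists x.
apply: (proj2 (vanishes_at_line _ _ _ h (r0 x))) Px => c c0.
by rewrite -[RHS](hx x x0 c c0); apply: meval_eq => i; rewrite rE.
Qed.

End Graph.

(** * The two inclusions *)

Theorem corollary2p11 (K : finFieldType) (q : nat) (hq : #|K| = q)
    (hq2 : q <> 2%N) (n s : nat) (e : rel 'I_n) (he : simple_graph e)
    (hs : (1 <= s)%N) (f : 'I_s -> {set 'I_n}) (hf : edge_listing e f)
    (hG : bipartite e \/ gcdn (q - 1) 2 = 1%N) :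
  forall h : {mpoly K[s.+1]},
    vanishing_ideal (projY (K := K) f) h <->
    ideal_add
      (extension (vanishing_ideal (projX (K := K) f)))
      (ideal_gen
         (fun g => g = 'X_(ord0 : 'I_s.+1) ^+ (q - 1) - 'X_ord_max ^+ (q - 1)))
      h.
Proof.
case: s hs f hf => // s _ f hf h; subst q.
have widen_lift i : unlift ord_max (widen_ord (leqnSn s.+1) i) = Some i.
  have -> : widen_ord (leqnSn s.+1) i = lift ord_max i.
    by apply/val_inj; rewrite /= /bump leqNgt ltn_ord.
  exact: liftK.
have ord0E : ord0 = widen_ord (leqnSn s.+1) ord0 by apply/val_inj.
split.
- set J := ideal_gen _.
  have idE : is_ideal _ (extension (vanishing_ideal (projX (K := K) f))).
    exact: ideal_gen_is_ideal.
  have [_ _ EM] := idE.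
  have idJ : is_ideal _ J by apply: ideal_gen_is_ideal.
  apply: ideal_gen_min; first exact: ideal_add_is_ideal.
  move=> {}h [[d hd] /vanishes_projY hY].
  have q1 : (0 < #|K| - 1)%N by rewrite subn_gt0 finNzRing_gt1.
  have [c [chom hJ]] := reduce_last _ _ _ h q1.
  exists (\sum_(k < #|K| - 1) mwiden (c k) * 'X_ord_max ^+ k).
  eexists; split; last by split; [exact: hJ | rewrite addrC subrK].
  apply: is_ideal_sum => // k _; rewrite mulrC; apply: EM; apply: mem_ideal_gen.
  exists (c k) => //; apply: mem_ideal_gen.
  split; first by exists (d - k)%N; apply: chom.
  apply/vanishes_projX => x x0 l l0; move: k.
  apply: coef_eq0_of_vanishes_on_units => m m0.
  (* Scaling x by z with all edge monomials equal to l/m gives a point of Y; its representative with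
     last coordinate m has first coordinates l x^(v_i), whatever m is. *)
  have lm0 : m^-1 * l != 0 by rewrite mulf_neq0 ?invr_eq0.
  have [z z0 zE] := exists_uniform_scaling _ _ _ _ _ _ he hf hG lm0.
  have xz0 j : (\row_j (x 0 j * z 0 j)) 0 j != 0 by rewrite mxE mulf_neq0.
  have := hY _ xz0 m m0.
  set w := (fun i => _).
  have wE i : w (widen_ord (leqnSn s.+1) i) = l * monval x (charvec (f i)).
    by rewrite /w widen_lift /= monvalM zE mulrCA mulVKf // mulrC.
  have wl : w ord_max = m by rewrite /w unlift_none mulr1.
  have -> : h.@[w] =
      \sum_k (c k).@[fun i => l * monval x (charvec (f i))] * m ^+ k.
    (* [h] and its reduction agree at [w]: they differ by a multiple of t_1^(q-1) - u^(q-1), and the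
       coordinates of [w] involved are units, with (q-1)-th power 1. *)
    rewrite -[h](subrK (\sum_(k < #|K| - 1) mwiden (c k) * 'X_ord_max ^+ k)).
    rewrite mevalD (_ : (_ - _).@[w] = 0) ?add0r; last first.
      move: hJ; apply: (ideal_gen_min _ _ (fun g => g.@[w] = 0)).
        split=> [|a b a0 b0|a b b0]; first exact: meval0.
          by rewrite mevalD a0 b0 addr0.
        by rewrite mevalM b0 mulr0.
      move=> _ ->; rewrite mevalB !rmorphXn /= !mevalXU wl ord0E wE.
      by rewrite !expf_card_pred ?subrr // mulf_neq0 ?monval_neq0.
    rewrite (big_morph _ (mevalD _) (meval0 _)); apply: eq_bigr => k _.
    rewrite mevalM rmorphXn /= mevalXU wl meval_mwiden; congr (_ * _).
    exact: meval_eq.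
  by [].
- have idY : is_ideal _ (vanishing_ideal (projY (K := K) f)).
    exact: ideal_gen_is_ideal.
  have [Y0 YD YM] := idY.
  case=> a [b [Ea [Jb ->]]]; apply: (YD).
    (* Generators are unfolded twice: those of the extension are widened elements of I(X), which in
       turn come from homogeneous polynomials vanishing on X. *)
    move: Ea; apply: ideal_gen_min => // _ [g gX ->]; move: gX.
    apply: (ideal_gen_min _ _ (fun g => vanishing_ideal _ (mwiden g))).
      split=> [|u v|u v]; first by rewrite mwiden0.
        by rewrite mwidenD; apply: YD.
      by rewrite mwidenM; apply: YM.
    move=> {}g [[d hd] /vanishes_projX gX]; apply: mem_ideal_gen.
    split; first by exists d; apply: dhomog_mwiden.
    apply/vanishes_projY => x x0 c c0.
    rewrite meval_mwiden -[RHS](gX x x0 c c0).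
    by apply: meval_eq => i; rewrite widen_lift.
  (* The binomial is itself a generator of I(Y): it is homogeneous, and both of its terms equal 1 at
     units. *)
  move: Jb; apply: ideal_gen_min => // _ ->; apply: mem_ideal_gen; split.
    exists (#|K| - 1)%N; rewrite !mpolyXn.
    by apply: rpredB; rewrite dhomogX /= mdegMn mdeg1 mul1n.
  apply/vanishes_projY => x x0 c c0.
  rewrite mevalB !rmorphXn /= !mevalXU unlift_none ord0E widen_lift /=.
  by rewrite !expf_card_pred ?subrr // mulf_neq0 ?monval_neq0 ?oner_neq0.
Qed.
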